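(* Let $n=n_1+n_2$. (1) Let $G_1,G_2\in\mathrm{Gr}_{n_1,n}(\mathbb{R})$ be two elements whose corresponding Plücker coordinates have the same signs, and assume the generic situation in which all Plücker coordinates are nonzero. Choose representative $n_1\times n$ matrices $(I_{n_1}\ A)$ for $G_1$ and $(I_{n_1}\ B)$ for $G_2$, and let $$L=\begin{pmatrix} I_{n_1}&A\\-B^t&I_{n_2}\end{pmatrix}.$$ Then $\det L>0$ and, with $M=L^{-1}$, the matrices $$A_1=M\begin{pmatrix}I_{n_1}&0\\0&0\end{pmatrix}M^{-1},\qquad A_2=M\begin{pmatrix}0&0\\0&I_{n_2}\end{pmatrix}M^{-1}$$ define a pure $2$-determinantal measure on $[2]^n$, which gives positive probability to every sequence in $[2]^n$ having exactly $n_1$ ones and $n_2$ twos. The nongeneric situation (in which some Plücker coordinates vanish) can be obtained from a limit of generic cases. (2) This construction is general: it gives all pure $2$-determinantal measures. That is, every pure $2$-determinantal measure on $[2]^n$ whose matrices $A_1,A_2$ have ranks $n_1,n_2$ is obtained by the construction in (1) from a pair of elements of $\mathrm{Gr}_{n_1,n}(\mathbb{R})$ having corresponding Plücker coordinates of the same signs, where the nongeneric cases are obtained as limits of generic ones.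
   Context: $[2]=\{1,2\}$. A $2$-determinantal measure on $[2]^n$ with matrices $A_1,A_2$ is a probability measure on $[2]^n$, where $A_1,A_2$ are real $n\times n$ matrices with $A_1+A_2=I$, and for all $(i_1,\dots,i_n)\in[2]^n$, $\Pr((i_1,\dots,i_n))=\det(A_{i_1}^1,A_{i_2}^2,\dots,A_{i_n}^n)$, the determinant of the matrix whose $j$th column is the $j$th column of $A_{i_j}$. Matrices $A_1,A_2$ with $A_1+A_2=I$ define such a measure when all these determinants are nonnegative (they then sum to $1$). The measure is pure if $\operatorname{rank}(A_1)+\operatorname{rank}(A_2)=n$. $\mathrm{Gr}_{n_1,n}(\mathbb{R})$ is the space of $n_1$-planes in $\mathbb{R}^n$, presented as real $n_1\times n$ matrices of rank $n_1$ modulo the left action of $\mathrm{GL}_{n_1}(\mathbb{R})$. The Plücker coordinates of an element are the maximal ($n_1\times n_1$) minors of a representative matrix, defined up to a common nonzero factor; for the representatives $(I_{n_1}\ A)$ and $(I_{n_1}\ B)$ the first Plücker coordinate is normalized to be $1$.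
   Formalization: In (2), ''same signs'' means never opposite: a coordinate may vanish at only one of the two planes. The generic pairs in the limit are shown to have the same signs only if the zeros of G1 and G2 match; same-sign generic pairs near (G1,G2) need not exist otherwise (n1=3, n2=4). *)

(* Defs.v *)
From mathcomp Require Import all_boot all_order all_algebra.
From mathcomp Require Import all_classical all_reals all_analysis.

Set Implicit Arguments.
Unset Strict Implicit.
Unset Printing Implicit Defensive.

Import Order.TTheory GRing.Theory Num.Theory.
Import numFieldNormedType.Exports.

Local Open Scope classical_set_scope.
Local Open Scope ring_scope.

Section Determinantal.
Context {R : realType}.

(* A sequence in [2]^n is a w : {ffun 'I_n -> 'I_2}; the letter 1 is encoded by
   ord0 and the letter 2 by ord_max. *)
Definition det2_pr n (A1 A2 : 'M[R]_n) (w : {ffun 'I_n -> 'I_2}) : R :=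
  \det (\matrix_(i < n, j < n) (if w j == ord0 then A1 i j else A2 i j)).

Definition det2_measure n (A1 A2 : 'M[R]_n) : Prop :=
  [/\ A1 + A2 = 1%:M,
      forall w, 0 <= det2_pr A1 A2 w &
      \sum_w det2_pr A1 A2 w = 1].

Definition pure_det2_measure n (A1 A2 : 'M[R]_n) : Prop :=
  det2_measure A1 A2 /\ (\rank A1 + \rank A2 = n)%N.

(* A point of Gr_{m,n}(R) is given by a matrix U : 'M_(m, n) with row_free U;
   gr_eq is the left action of GL_m by which such matrices are identified. *)
Definition gr_eq m n (U V : 'M[R]_(m, n)) : Prop :=
  exists2 g : 'M[R]_m, g \in unitmx & U = g *m V.

(* Convergence in the quotient topology of Gr_{m,n}(R): the quotient map is
   open, so a sequence of classes converges iff suitable representatives do. *)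
Definition gr_cvg m n (U_ : nat -> 'M[R]_(m, n)) (U : 'M[R]_(m, n)) : Prop :=
  exists2 V_ : nat -> 'M[R]_(m, n),
    forall k, gr_eq (V_ k) (U_ k) & V_ k @[k --> \oo] --> U.

(* Pluecker coordinates are indexed by the m-subsets of the columns, given by
   their increasing enumerations f : 'I_m -> 'I_n. *)
Definition increasing m n (f : 'I_m -> 'I_n) : Prop :=
  forall i j : 'I_m, (i < j)%N -> (f i < f j)%N.

Definition plucker m n (U : 'M[R]_(m, n)) (f : 'I_m -> 'I_n) : R :=
  \det (colsub f U).

Definition generic m n (U : 'M[R]_(m, n)) : Prop :=
  forall f, increasing f -> plucker U f != 0.

(* Pluecker coordinates are defined up to a common nonzero factor c, and the
   sign of 0 is 0. *)
Definition same_signs m n (U1 U2 : 'M[R]_(m, n)) : Prop :=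
  exists2 c : R, c != 0 &
    forall f, increasing f ->
      Num.sg (c * plucker U1 f) = Num.sg (plucker U2 f).

(* Here a coordinate is allowed to vanish at U1 and not at U2, or conversely,
   but at least one coordinate vanishes at neither. On matrices of full row
   rank this follows from same_signs, and on generic matrices it is
   equivalent to it. *)
Definition compatible_signs m n (U1 U2 : 'M[R]_(m, n)) : Prop :=
  exists c : R,
    (forall f, increasing f -> 0 <= c * plucker U1 f * plucker U2 f) /\
    (exists2 f, increasing f & 0 < c * plucker U1 f * plucker U2 f).

Section Construction.
Variables n1 n2 : nat.
Implicit Types A B : 'M[R]_(n1, n2).

Definition gr_chart A : 'M[R]_(n1, n1 + n2) := row_mx 1%:M A.

Definition Lmx A B : 'M[R]_(n1 + n2) := block_mx 1%:M A (- B^T) 1%:M.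

Definition Mmx A B : 'M[R]_(n1 + n2) := invmx (Lmx A B).

Definition constr1 A B : 'M[R]_(n1 + n2) :=
  Mmx A B *m block_mx 1%:M 0 0 0 *m invmx (Mmx A B).

Definition constr2 A B : 'M[R]_(n1 + n2) :=
  Mmx A B *m block_mx 0 0 0 1%:M *m invmx (Mmx A B).

(* The sequence of pairs (A_ k, B_ k) presents (U1, U2) as a limit of pairs
   all of whose Pluecker coordinates are nonzero. *)
Definition generic_approx (U1 U2 : 'M[R]_(n1, n1 + n2))
    (A_ B_ : nat -> 'M[R]_(n1, n2)) : Prop :=
  [/\ forall k, generic (gr_chart (A_ k)) /\ generic (gr_chart (B_ k)),
      gr_cvg (fun k => gr_chart (A_ k)) U1 &
      gr_cvg (fun k => gr_chart (B_ k)) U2].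

(* (A1, A2) is the value of the construction at (U1, U2), obtained as a limit
   of generic cases: there are generic approximations with L invertible, with
   the same signs if U1 and U2 have the same signs, and the construction tends
   to (A1, A2) along every generic approximation. *)
Definition limit_construction (U1 U2 : 'M[R]_(n1, n1 + n2))
    (A1 A2 : 'M[R]_(n1 + n2)) : Prop :=
  (exists A_ B_ : nat -> 'M[R]_(n1, n2),
     [/\ generic_approx U1 U2 A_ B_,
         forall k, Lmx (A_ k) (B_ k) \in unitmx &
         same_signs U1 U2 ->
           forall k, same_signs (gr_chart (A_ k)) (gr_chart (B_ k))]) /\
  (forall A_ B_ : nat -> 'M[R]_(n1, n2), generic_approx U1 U2 A_ B_ ->
     constr1 (A_ k) (B_ k) @[k --> \oo] --> A1 /\
     constr2 (A_ k) (B_ k) @[k --> \oo] --> A2).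

End Construction.

End Determinantal.

(* Main.v *)
(** If [U] and [V] are [m x n] matrices with [G = U *m V^T] invertible, let
    [K = V^T *m G^-1 *m U], the projection with the same rows as [U] and the
    same columns as [V^T]. It depends only on the classes of [U] and [V] in the
    Grassmannian, and in the charts it is the matrix [constr1 A B]. For a set
    [S] of columns with indicator matrix [D], the determinant obtained by
    choosing the columns of [K] on [S] and those of [1 - K] off [S], times
    [\det G], is the product of the [S]-th Pluecker coordinates of [U] and [V]
    if [#|S| = m] and [0] otherwise. By Cauchy-Binet [\det G] is the sum of
    these products, so compatible signs make [\det G] nonzero and the measure
    nonnegative. Conversely, purity forces [A1] to be idempotent, and a rank
    factorization [A1 = V^T *m U] then has [U *m V^T = 1].

    As [K] is continuous where [\det G] does not vanish, limits of generic
    cases exist once generic approximations do. These are given by [U *m T x]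
    and [V *m T x] with [T x] a deformation of the identity such that each
    Pluecker coordinate of [U *m T x] is a combination of distinct powers of
    [x] whose coefficients are, up to order and sign, all the Pluecker
    coordinates of [U]: for small [x > 0] its sign is that of the coefficient
    of lowest order, and this preserves equality of signs. *)

Require Import Defs.
From mathcomp Require Import all_boot all_order all_fingroup all_algebra.
From mathcomp Require Import all_classical all_reals all_analysis.
From mathcomp Require Import ring.

Import Order.TTheory GRing.Theory Num.Theory.
Import numFieldNormedType.Exports.

Local Open Scope classical_set_scope.
Local Open Scope ring_scope.

(** * Determinants attached to subsets of columns, and Cauchy-Binet *)

Section SubsetMinors.
Set Implicit Arguments.
Unset Strict Implicit.
Context {R : comNzRingType} {m n : nat}.
Implicit Types (U V : 'M[R]_(m, n)) (S : {set 'I_n}).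

Definition indic_mx S : 'M[R]_n := diag_mx (\row_j (j \in S)%:R).

Lemma mul_indic_mx p (A : 'M[R]_(p, n)) S i j :
  (A *m indic_mx S) i j = A i j * (j \in S)%:R.
Proof. by rewrite mul_mx_diag !mxE. Qed.

(** Makes a product of two minors on the same columns depend only on the set of these columns: the
    sum over [i : 'I_m] is reindexed along [f] as a sum over its image. *)
Lemma colsub_mul_tr U V (f : 'I_m -> 'I_n) : injective f ->
  colsub f U *m (colsub f V)^T = U *m indic_mx [set f i | i : 'I_m]%SET *m V^T.
Proof.
move=> finj; apply/matrixP => i j; rewrite !mxE.
under [RHS]eq_bigr => k _ do rewrite mul_indic_mx mxE.
rewrite (bigID (mem [set f i | i : 'I_m]%SET)) /= [X in _ + X]big1; last first.
  by move=> k /negPf ->; rewrite mulr0 mul0r.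
rewrite addr0 big_imset /= => [|x y _ _ /finj //].
by apply: eq_bigr => k _; rewrite !mxE imset_f // mulr1.
Qed.

(* Multiplying the first block column by 'X makes the block matrix with
   1 - D + 'X D in place of 1 - D block triangular; the identity at 'X = 0
   is the coefficient of 'X^m. *)
Lemma det_select_block U V S :
  \det (block_mx 0 (- U) (indic_mx S *m V^T) (1%:M - indic_mx S)) =
  if #|S| == m then \det (U *m indic_mx S *m V^T) else 0.
Proof.
pose C p q (A : 'M[R]_(p, q)) : 'M[{poly R}]_(p, q) := map_mx polyC A.
pose Y : 'M[{poly R}]_n := diag_mx (\row_j (if j \in S then 'X else 1)).
pose B : 'M[{poly R}]_(m + n) :=
  block_mx 0 (- C _ _ U) (C _ _ (indic_mx S *m V^T)) Y.
have YS : Y *m C _ _ (indic_mx S *m V^T) = 'X *: C _ _ (indic_mx S *m V^T).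
  apply/matrixP => i j; rewrite /Y /indic_mx !mul_diag_mx !mxE.
  by case: (i \in S); rewrite // mul0r polyC0 !mulr0.
have detY : \det Y = 'X^#|S|.
  rewrite det_diag; under eq_bigr do rewrite mxE.
  by rewrite -big_mkcond /= prodr_const.
have E : \det B * 'X^m = \det (C _ _ (U *m indic_mx S *m V^T)) * 'X^#|S|.
  have <- : \det (block_mx (@scalar_mx _ m 'X) 0
      (- C _ _ (indic_mx S *m V^T)) (@scalar_mx _ n 1)) = 'X^m.
    by rewrite det_lblock det1 mulr1 det_scalar.
  rewrite -det_mulmx mulmx_block !mul0mx !mulmx0 !mulmx1 !add0r.
  rewrite mulmxN mulNmx opprK mulmxN YS mul_mx_scalar subrr.
  by rewrite det_ublock detY /C -map_mxM /= mulmxA.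
have : (\det B * 'X^m)`_m =
    \det (block_mx 0 (- U) (indic_mx S *m V^T) (1%:M - indic_mx S)).
  rewrite coefMXn ltnn subnn -horner_coef0 -[LHS]/(horner_eval 0 (\det B)) -det_map_mx.
  congr (\det _); rewrite map_block_mx; congr block_mx.
  - by apply/matrixP => i j; rewrite !mxE /= rmorph0.
  - by apply/matrixP => i j; rewrite !mxE /= rmorphN /= /horner_eval hornerC.
  - by apply/matrixP => i j; rewrite !mxE /= /horner_eval hornerC.
  - apply/matrixP => i j; rewrite !mxE /=; case: eqP => [->|_]; last first.
      by rewrite !mulr0n subr0 rmorph0.
    by case: (j \in S); rewrite !mulr1n /horner_eval ?hornerX ?hornerC ?subrr ?subr0.
rewrite E /C det_map_mx coefCM coefXn eq_sym => <-.
by case: eqP => _; rewrite ?mulr1 ?mulr0.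
Qed.

(** Multilinear expansion along the rows of [A]. Noninjective [f] contribute 0 and are kept, so that
    the index set is a finite function type. *)
Lemma det_mulmx_ffun (A : 'M[R]_(m, n)) (B : 'M[R]_(n, m)) :
  \det (A *m B) =
  \sum_(f : {ffun 'I_m -> 'I_n}) (\prod_i A i (f i)) * \det (rowsub f B).
Proof.
transitivity (\sum_(s : 'S_m) \sum_(f : {ffun 'I_m -> 'I_n})
    (-1) ^+ s * ((\prod_i A i (f i)) * \prod_i B (f i) (s i))).
  apply: eq_bigr => s _; rewrite -big_distrr /=; congr (_ * _).
  under eq_bigr do rewrite mxE.
  rewrite bigA_distr_bigA /=; apply: eq_bigr => f _.
  by rewrite big_split.
rewrite exchange_big; apply: eq_bigr => f _ /=.
rewrite big_distrr /=; apply: eq_bigr => s _.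
by rewrite mulrCA; congr (_ * (_ * _)); apply: eq_bigr => i _; rewrite mxE.
Qed.

(* A symmetric form of the Cauchy-Binet formula, without a choice of
   orderings of the subsets of columns. *)
Lemma det_mulmx_tr U V :
  (\det (U *m V^T)) *+ m`! =
  \sum_(f : {ffun 'I_m -> 'I_n}) \det (colsub f U) * \det (colsub f V).
Proof.
transitivity (\sum_(s : 'S_m) \det (U *m V^T)).
  by rewrite sumr_const card_Sn.
transitivity (\sum_(s : 'S_m) \sum_(f : {ffun 'I_m -> 'I_n})
    (-1) ^+ s * (\prod_i U (s i) (f i)) * \det (colsub f V)).
  apply: eq_bigr => s _.
  have -> : \det (U *m V^T) = (-1) ^+ s * \det (row_perm s U *m V^T).
    have -> : row_perm s U *m V^T = perm_mx s *m (U *m V^T).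
      by rewrite row_permE mulmxA.
    by rewrite det_mulmx det_perm mulrA -expr2 sqrr_sign mul1r.
  rewrite det_mulmx_ffun big_distrr; apply: eq_bigr => f _ /=; rewrite mulrA.
  congr (_ * _ * _); first by apply: eq_bigr => i _; rewrite mxE.
  by rewrite -[RHS]det_tr; congr (\det _); apply/matrixP => i j; rewrite !mxE.
rewrite exchange_big; apply: eq_bigr => f _ /=; rewrite -big_distrl /=.
congr (_ * _); rewrite -[RHS]det_tr; apply: eq_bigr => s _; congr (_ * _).
by apply: eq_bigr => i _; rewrite !mxE.
Qed.

End SubsetMinors.

(** * The oblique projection and its mixed-column determinants *)

Section ObliqueProjection.
Set Implicit Arguments.
Unset Strict Implicit.
Context {F : fieldType} {m n : nat}.
Implicit Types (U V : 'M[F]_(m, n)) (S : {set 'I_n}).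

(* The adjugate makes this a rational function of the entries of U and V; the
   value is meaningful only if U *m V^T is invertible. *)
Definition oblique_proj U V : 'M[F]_n :=
  V^T *m ((\det (U *m V^T))^-1 *: \adj (U *m V^T)) *m U.

Lemma oblique_projE U V : \det (U *m V^T) != 0 ->
  oblique_proj U V = V^T *m invmx (U *m V^T) *m U.
Proof. by move=> G0; rewrite /oblique_proj /invmx unitmxE unitfE G0. Qed.

Lemma oblique_proj_mul (g h : 'M[F]_m) U V :
  g \in unitmx -> h \in unitmx -> \det (U *m V^T) != 0 ->
  oblique_proj (g *m U) (h *m V) = oblique_proj U V.
Proof.
move=> gu hu G0; have Gu : U *m V^T \in unitmx by rewrite unitmxE unitfE.
have htu : h^T \in unitmx by rewrite unitmx_tr.
have E : g *m U *m (h *m V)^T = g *m (U *m V^T) *m h^T.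
  by rewrite trmx_mul !mulmxA.
have Eu : g *m (U *m V^T) *m h^T \in unitmx.
  by rewrite !unitmx_mul gu Gu htu.
rewrite !oblique_projE // E; last by rewrite -unitfE -unitmxE.
have -> : invmx (g *m (U *m V^T) *m h^T) = invmx h^T *m invmx (U *m V^T) *m invmx g.
  rewrite -[RHS](mulmxK Eu) -[LHS]mul1mx; congr (_ *m _).
  move: (U *m V^T) Gu => G Gu.
  by rewrite !mulmxA (mulmxKV gu) (mulmxKV Gu) mulVmx.
rewrite trmx_mul !mulmxA (mulmxK htu) -[in LHS](mulmxA _ (invmx g)) mulVmx //.
by rewrite mulmx1.
Qed.

Lemma mul_oblique_proj U V : \det (U *m V^T) != 0 -> U *m oblique_proj U V = U.
Proof.
move=> G0; rewrite oblique_projE // !mulmxA mulmxV ?mul1mx //.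
by rewrite unitmxE unitfE.
Qed.

Lemma oblique_proj_idem U V : \det (U *m V^T) != 0 ->
  oblique_proj U V *m oblique_proj U V = oblique_proj U V.
Proof.
move=> G0; rewrite {1}(@oblique_projE U V) // -!mulmxA mul_oblique_proj // !mulmxA.
by rewrite -oblique_projE.
Qed.

Lemma mxrank_idem_compl (A : 'M[F]_n) : A *m A = A ->
  (\rank A + \rank (1%:M - A)%R = n)%N.
Proof.
move=> AA; apply/eqP; rewrite eqn_leq; apply/andP; split.
  by apply: mulmx0_rank_max; rewrite mulmxBr mulmx1 AA subrr.
rewrite -[X in (X <= _)%N](@mxrank1 F n) -[X in \rank X](subrK A) addrC.
exact: mxrank_add.
Qed.

(** Both sides are determinants of matrices obtained from one block matrix [Z] by unimodular block
    operations: a Schur complement gives the left side, and the other operations lead to the matrix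
    of [det_select_block]. *)
Lemma det_select_oblique_proj U V S : \det (U *m V^T) != 0 ->
  \det (U *m V^T) *
  \det (oblique_proj U V *m indic_mx S +
        (1%:M - oblique_proj U V) *m (1%:M - indic_mx S)) =
  if #|S| == m then \det (U *m indic_mx S *m V^T) else 0.
Proof.
move=> G0; rewrite -det_select_block.
have Gu : U *m V^T \in unitmx by rewrite unitmxE unitfE.
set D := indic_mx S; set K := oblique_proj U V.
(* With this [E], the selected matrix is [(1 - D) + K *m E], the Schur complement of [U *m V^T] in
   [Z]. *)
pose E : 'M[F]_n := D + D - 1%:M.
pose Z : 'M[F]_(m + n) := block_mx (U *m V^T) (- (U *m E)) V^T (1%:M - D).
transitivity (\det Z).
  have <- : \det (Z *m block_mx 1%:M (invmx (U *m V^T) *m U *m E) 0 1%:M) = \det Z.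
    by rewrite det_mulmx det_ublock !det1 !mulr1.
  rewrite mulmx_block !mulmx1 !mulmx0 !addr0 !mulmxA mulmxV // mul1mx.
  rewrite addrN det_lblock -oblique_projE //; congr (_ * \det _).
  rewrite /E mulmxBl mulmxBr mulmxDr !mulmx1 mul1mx.
  rewrite mulmxBr mulmx1 mulmxDr mulmxN -/K.
  move: (K *m D) => KD; move: (K) (D) => K' D'.
  apply/matrixP => i j; rewrite !mxE.
  ring.
(* The row operation turns the top blocks into [- U *m V^T] and [- U]; the column operation then
   cancels the former and leaves [D *m V^T] below it. *)
have <- : \det (block_mx 1%:M (- (U + U)) 0 1%:M *m Z *m
    block_mx 1%:M 0 (- V^T) 1%:M) = \det Z.
  by rewrite !det_mulmx det_ublock det_lblock !det1 !mulr1 mul1r.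
congr (\det _).
have UE : - (U *m E) + - (U + U) *m (1%:M - D) = - U.
  rewrite /E mulNmx !mulmxDl !mulmxBr !mulmxDr !mulmx1.
  move: (U *m D) => UD.
  by apply/matrixP => i j; rewrite !mxE; ring.
rewrite !mulmx_block !mulmx1 !mulmx0 !mul1mx !mul0mx !add0r UE; congr block_mx.
- by rewrite mulmxN !mulNmx opprK mulmxDl opprD addrA subrr sub0r addNr.
- by rewrite mulmxN mulmxBl mul1mx opprB addrC subrK.
Qed.

End ObliqueProjection.

(** * Signs of Plücker coordinates *)

Section PluckerSigns.
Set Implicit Arguments.
Unset Strict Implicit.
Context {R : realType} {m n : nat}.
Implicit Types (U V : 'M[R]_(m, n)) (S : {set 'I_n}) (f g : 'I_m -> 'I_n).

Lemma increasing_inj f : increasing f -> injective f.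
Proof.
move=> fI i j fij; apply/ord_inj.
by case: (ltngtP i j) => // /fI; rewrite fij ltnn.
Qed.

Lemma exists_increasing S : #|S| = m ->
  exists2 g : 'I_m -> 'I_n, increasing g & [set g i | i : 'I_m]%SET = S.
Proof.
move=> Sm; exists (fun i => enum_val (cast_ord (esym Sm) i)); last first.
  apply/setP => x; apply/imsetP/idP => [[i _ ->]|xS]; first exact: enum_valP.
  by exists (cast_ord Sm (enum_rank_in xS x)); rewrite // cast_ordK enum_rankK_in.
have eS : sorted (fun i j : 'I_n => (i < j)%N) (enum S).
  rewrite /enum_mem -enumT; apply: sorted_filter; first by move=> ? ? ?; apply: ltn_trans.
  rewrite -(@sorted_map _ _ val ltn) val_enum_ord.
  exact: iota_ltn_sorted.
move=> i j ij; have x0 := enum_val (cast_ord (esym Sm) i).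
rewrite !(enum_val_nth x0).
apply: (sorted_ltn_nth _ x0 eS) => //; rewrite ?inE -?cardE ?Sm //.
by move=> ? ? ?; apply: ltn_trans.
Qed.

Lemma plucker_mul_tr U V f : injective f ->
  plucker U f * plucker V f =
  \det (U *m indic_mx [set f i | i : 'I_m]%SET *m V^T).
Proof. by move=> finj; rewrite -colsub_mul_tr // det_mulmx det_tr. Qed.

(** The sign is that of the permutation sorting [f], hence the same for all [U]. It therefore
    cancels in products and in comparisons of signs. *)
Lemma plucker_increasing f : injective f ->
  exists2 g, increasing g &
    exists b : bool, forall U, plucker U f = (-1) ^+ b * plucker U g.
Proof.
move=> finj; have [|g gI gS] := @exists_increasing [set f i | i : 'I_m]%SET.
  by rewrite card_imset // card_ord.
have /fin_all_exists [s fE] i : exists k, f i = g k.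
  have : f i \in [set g k | k : 'I_m]%SET by rewrite gS imset_f.
  by move=> /imsetP [k _ ->]; exists k.
have sinj : injective s by move=> i j sij; apply: finj; rewrite !fE sij.
exists g => //; exists (perm sinj) => U.
rewrite /plucker.
have -> : colsub f U = col_perm (perm sinj) (colsub g U).
  by apply/matrixP => i j; rewrite !mxE permE fE.
by rewrite col_permE det_mulmx det_perm odd_permV mulrC.
Qed.

Lemma plucker_mul_increasing f : injective f ->
  exists2 g, increasing g &
    forall U V, plucker U f * plucker V f = plucker U g * plucker V g.
Proof.
move=> /plucker_increasing [g gI [b E]]; exists g => // U V.
by rewrite !E mulrACA -expr2 sqrr_sign mul1r.
Qed.

Lemma plucker_mul (h : 'M[R]_m) U f : plucker (h *m U) f = \det h * plucker U f.
Proof.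
rewrite /plucker -det_mulmx; congr (\det _); apply/matrixP => i j.
by rewrite !mxE; apply: eq_bigr => k _; rewrite !mxE.
Qed.

Lemma plucker_noninj U f : ~ injective f -> plucker U f = 0.
Proof.
move=> finj; rewrite /plucker -det_tr.
have [i [j [ij fij]]] : exists i j, i != j /\ f i = f j.
  apply: contrapT => H; apply: finj => i j fij; apply/eqP/negPn/negP => ij.
  by apply: H; exists i, j.
by apply: (determinant_alternate ij) => k; rewrite !mxE fij.
Qed.

Lemma row_free_plucker U : row_free U -> exists2 f, increasing f & plucker U f != 0.
Proof.
move=> Uf.
have [f finj f0] : exists2 f, injective f & plucker U f != 0.
  have Ut : row_full U^T by rewrite /row_full mxrank_tr.
  exists (fullrankfun Ut); first exact: fullrankfun_inj.
  have := fullrowsub_unit Ut; rewrite unitmxE unitfE -det_tr.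
  by congr (\det _ != 0); apply/matrixP => i j; rewrite !mxE.
have [g gI [b E]] := plucker_increasing finj; exists g => //.
by apply: contraNneq f0; rewrite E => ->; rewrite mulr0.
Qed.

(** After scaling by [c], all terms of [det_mulmx_tr] are nonnegative, as noninjective ones vanish
    and injective ones reduce to increasing ones; the term of [f0] is positive. *)
Lemma det_mulmx_tr_gt0 U V (c : R) :
  (forall f, increasing f -> 0 <= c * plucker U f * plucker V f) ->
  (exists2 f, increasing f & 0 < c * plucker U f * plucker V f) ->
  0 < c * \det (U *m V^T).
Proof.
move=> ge0 [f0 f0I f0gt].
have ge0' f : 0 <= c * plucker U f * plucker V f.
  have [finj|/plucker_noninj ->] := pselect (injective f); last by rewrite mulr0 mul0r.
  by have [g gI] := plucker_mul_increasing finj; rewrite -mulrA => ->; rewrite mulrA ge0.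
rewrite -(pmulrn_lgt0 _ (fact_gt0 m)) -mulrnAr det_mulmx_tr.
rewrite mulr_sumr (bigD1 (finfun f0)) //=.
have E (f : {ffun 'I_m -> 'I_n}) : c * (\det (colsub f U) * \det (colsub f V)) =
  c * plucker U f * plucker V f by rewrite mulrA.
rewrite ltr_pwDl //; last by apply: sumr_ge0 => f _; rewrite E.
have -> : colsub (finfun f0) U = colsub f0 U by apply/matrixP => i j; rewrite !mxE ffunE.
have -> : colsub (finfun f0) V = colsub f0 V by apply/matrixP => i j; rewrite !mxE ffunE.
by rewrite mulrA.
Qed.

(** Full row rank gives a coordinate nonzero at [V], hence at [U] by equality of signs; the same [c]
    serves. *)
Lemma same_signs_compatible U V : row_free V -> same_signs U V -> compatible_signs U V.
Proof.
move=> /row_free_plucker [f0 f0I f0n] [c c0 sg].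
have ge0 f : increasing f ->
    Num.sg (c * plucker U f * plucker V f) = `|Num.sg (plucker V f)|.
  by move=> /sg fE; rewrite sgrM fE normr_sg -expr2 sqr_sg.
exists c; split=> [f fI|]; first by rewrite -sgr_ge0 ge0.
by exists f0 => //; rewrite -sgr_gt0 ge0 // normr_gt0 sgr_eq0.
Qed.

End PluckerSigns.

(** * The measure defined by an oblique projection *)

Section Measure.
Set Implicit Arguments.
Unset Strict Implicit.
Context {R : realType}.

Lemma sum_det2_pr n (A1 A2 : 'M[R]_n) :
  \sum_w det2_pr A1 A2 w = \det (A1 + A2).
Proof.
rewrite exchange_big; apply: eq_bigr => s _ /=; rewrite -big_distrr /=.
(* Each product runs over rows; reindexing by [s^-1] makes it run over columns, where the letters of
   [w] live, so that the sum over [w] distributes. *)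
congr (_ * _); rewrite (reindex_inj (@perm_inj _ s^-1)) /=.
transitivity (\prod_j \sum_(k : 'I_2)
    if k == ord0 then A1 ((s^-1)%g j) j else A2 ((s^-1)%g j) j).
  rewrite bigA_distr_bigA /=; apply: eq_bigr => w _.
  rewrite (reindex_inj (@perm_inj _ s^-1)) /=.
  by apply: eq_bigr => j _; rewrite mxE permKV.
by apply: eq_bigr => j _; rewrite !big_ord_recl big_ord0 /= addr0 mxE permKV.
Qed.

Lemma det2_pr_oblique_proj m n (U V : 'M[R]_(m, n)) w :
  \det (U *m V^T) != 0 ->
  \det (U *m V^T) * det2_pr (oblique_proj U V) (1%:M - oblique_proj U V) w =
  if #|[set j | w j == ord0]%SET| == m
  then \det (U *m indic_mx [set j | w j == ord0]%SET *m V^T) else 0.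
Proof.
move=> G0; rewrite -det_select_oblique_proj //; congr (_ * \det _).
apply/matrixP => i j; rewrite mulmxBr mulmx1 mxE [in RHS]mxE [X in _ = _ + X]mxE.
rewrite [X in _ = _ + (_ + X)]mxE !mul_indic_mx inE.
by case: (w j == ord0); rewrite ?mulr1 ?mulr0 ?subrr ?addr0 ?subr0 ?add0r.
Qed.

Lemma pure_oblique_proj m n (U V : 'M[R]_(m, n)) : compatible_signs U V ->
  pure_det2_measure (oblique_proj U V) (1%:M - oblique_proj U V).
Proof.
move=> [c [ge0 ex]]; have cG := det_mulmx_tr_gt0 ge0 ex.
have G0 : \det (U *m V^T) != 0 by apply: contraTneq cG => ->; rewrite mulr0 ltxx.
split; last exact/mxrank_idem_compl/oblique_proj_idem.
split=> [|w|]; [by rewrite addrC subrK | | by rewrite sum_det2_pr addrC subrK det1].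
(* Multiplied by the positive number [c * \det (U *m V^T)], a probability becomes [c] times a
   product of two Plücker coordinates, or 0. *)
rewrite -(pmulr_rge0 _ cG) -mulrA det2_pr_oblique_proj //.
case: eqP => [/exists_increasing [g gI <-]|_]; last by rewrite mulr0.
by rewrite -plucker_mul_tr ?mulrA ?ge0 //; exact: increasing_inj.
Qed.

Lemma det2_pr_oblique_proj_gt0 m n (U V : 'M[R]_(m, n)) (c : R) :
  (forall f, increasing f -> 0 < c * plucker U f * plucker V f) ->
  0 < c * \det (U *m V^T) ->
  forall w : {ffun 'I_n -> 'I_2}, #|[set j | w j == ord0]%SET| = m ->
    0 < det2_pr (oblique_proj U V) (1%:M - oblique_proj U V) w.
Proof.
move=> gt0 cG w wm.
have G0 : \det (U *m V^T) != 0 by apply: contraTneq cG => ->; rewrite mulr0 ltxx.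
rewrite -(pmulr_rgt0 _ cG) -mulrA det2_pr_oblique_proj // wm eqxx.
have [g gI <-] := exists_increasing wm.
by rewrite -plucker_mul_tr ?mulrA ?gt0 //; exact: increasing_inj.
Qed.

End Measure.

(** * The construction read in the affine charts *)

Section Charts.
Set Implicit Arguments.
Unset Strict Implicit.
Context {R : realType} {n1 n2 : nat}.
Implicit Types (A B : 'M[R]_(n1, n2)) (U V : 'M[R]_(n1, n1 + n2)).

Lemma det_Lmx A B : \det (Lmx A B) = \det (gr_chart A *m (gr_chart B)^T).
Proof.
have <- : \det (Lmx A B *m block_mx 1%:M 0 B^T 1%:M) = \det (Lmx A B).
  by rewrite det_mulmx det_lblock !det1 !mulr1.
rewrite mulmx_block !mulmx1 !mul1mx !mulmx0 !add0r addNr det_ublock det1 mulr1.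
by rewrite /gr_chart tr_row_mx mul_row_col trmx1 mulmx1.
Qed.

(** The last [n2] rows of [L] annihilate [(gr_chart B)^T], so [L] times the projection is
    [gr_chart A] above 0, which is also the block projection times [L]. *)
Lemma constr1E A B : \det (Lmx A B) != 0 ->
  constr1 A B = oblique_proj (gr_chart A) (gr_chart B).
Proof.
move=> L0; have Lu : Lmx A B \in unitmx by rewrite unitmxE unitfE.
move: (L0); rewrite det_Lmx => G0.
rewrite /constr1 /Mmx invmxK -mulmxA; apply: (canLR (mulKmx Lu)).
rewrite oblique_projE // !mulmxA.
have -> : Lmx A B *m (gr_chart B)^T = col_mx (gr_chart A *m (gr_chart B)^T) 0.
  rewrite /gr_chart tr_row_mx mul_row_col mul_block_col !trmx1 !mulmx1 mul1mx.
  by rewrite addNr.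
rewrite (mul_col_mx (gr_chart A *m _)) mulmxV ?unitmxE ?unitfE // mul0mx.
rewrite (mul_col_mx 1%:M) mul1mx mul0mx.
rewrite /Lmx mulmx_block !mul1mx !mul0mx !addr0.
by rewrite /gr_chart block_mxEv row_mx0.
Qed.

Lemma constr2E A B : \det (Lmx A B) != 0 -> constr2 A B = 1%:M - constr1 A B.
Proof.
move=> L0; have Lu : Lmx A B \in unitmx by rewrite unitmxE unitfE.
apply/(canRL (addrK _)); rewrite /constr1 /constr2 -mulmxDl -mulmxDr.
rewrite add_block_mx !addr0 !add0r -scalar_mx_block mulmx1 mulmxV //.
by rewrite unitmx_inv.
Qed.

Lemma plucker_chart A : plucker (gr_chart A) (@lshift n1 n2) = 1.
Proof.
rewrite /plucker -[RHS](det1 R n1); congr (\det _).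
by apply/matrixP => i j; rewrite mxE row_mxEl.
Qed.

Lemma gr_eq_chart U : plucker U (@lshift n1 n2) != 0 -> exists A, gr_eq U (gr_chart A).
Proof.
have UE : colsub (@lshift n1 n2) U = lsubmx U by apply/matrixP => i j; rewrite !mxE.
rewrite /plucker UE => Ul; have Uu : lsubmx U \in unitmx by rewrite unitmxE unitfE.
exists (invmx (lsubmx U) *m rsubmx U); exists (lsubmx U) => //.
by rewrite mul_mx_row mulmx1 mulKVmx // hsubmxK.
Qed.

Lemma lshift_increasing : increasing (@lshift n1 n2).
Proof. by move=> i j. Qed.

Lemma gr_eq_sym m n (U V : 'M[R]_(m, n)) : gr_eq U V -> gr_eq V U.
Proof.
by move=> [g gu ->]; exists (invmx g); rewrite ?unitmx_inv // mulKmx.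
Qed.

Lemma gr_eq_plucker m n (U V : 'M[R]_(m, n)) : gr_eq U V ->
  exists2 d : R, d != 0 & forall f, plucker U f = d * plucker V f.
Proof.
move=> [g gu ->]; exists (\det g); first by rewrite -unitfE -unitmxE.
exact: plucker_mul.
Qed.

Lemma gr_eq_oblique_proj m n (U U' V V' : 'M[R]_(m, n)) :
  gr_eq U' U -> gr_eq V' V -> \det (U *m V^T) != 0 ->
  oblique_proj U' V' = oblique_proj U V.
Proof. by move=> [g gu ->] [h hu ->] G0; apply: oblique_proj_mul. Qed.

(** The first Plücker coordinates of [U] and [V] are the determinants of the matrices relating them
    to the charts. This transfers nonvanishing and signs between [U *m V^T] and [L]. *)
Lemma det_Lmx_plucker U V A B : gr_eq U (gr_chart A) -> gr_eq V (gr_chart B) ->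
  \det (U *m V^T) =
  plucker U (@lshift n1 n2) * plucker V (@lshift n1 n2) * \det (Lmx A B).
Proof.
move=> [g gu ->] [h hu ->]; rewrite !plucker_mul !plucker_chart !mulr1.
rewrite trmx_mul mulmxA -(mulmxA g) !det_mulmx det_tr det_Lmx.
ring.
Qed.

End Charts.

(** * Limits of matrix expressions *)

Section MatrixLimits.
Set Implicit Arguments.
Unset Strict Implicit.
Context {R : realType} {T : Type} {F : set_system T} {FF : Filter F}.

Lemma cvg_mx m n (V_ : T -> 'M[R]_(m, n)) (U : 'M[R]_(m, n)) :
  (forall i j, V_ t i j @[t --> F] --> U i j) -> V_ t @[t --> F] --> U.
Proof.
move=> H A [P UP sPA]; apply: (filterS (P := fun t => forall i j, P i j (V_ t i j))).
  by move=> t Pt; apply: sPA.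
apply: filter_forall => i; apply: filter_forall => j.
exact: (H i j _ (UP i j)).
Qed.

Lemma cvg_mx_coord m n (V_ : T -> 'M[R]_(m, n)) (U : 'M[R]_(m, n)) i j :
  V_ t @[t --> F] --> U -> V_ t i j @[t --> F] --> U i j.
Proof.
move=> H; exact: (cvg_comp _ _ H (@coord_continuous _ _ _ i j U)).
Qed.

Lemma cvg_sumr (I : Type) (r : seq I) (P : pred I) (f : I -> T -> R) (a : I -> R) :
  (forall i, P i -> f i t @[t --> F] --> a i) ->
  (\sum_(i <- r | P i) f i t) @[t --> F] --> \sum_(i <- r | P i) a i.
Proof. by apply: cvg_big; exact: add_continuous. Qed.

Lemma cvg_prodr (I : Type) (r : seq I) (P : pred I) (f : I -> T -> R) (a : I -> R) :
  (forall i, P i -> f i t @[t --> F] --> a i) ->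
  (\prod_(i <- r | P i) f i t) @[t --> F] --> \prod_(i <- r | P i) a i.
Proof. by apply: cvg_big; exact: mul_continuous. Qed.

Lemma cvg_mulmx m n p (A_ : T -> 'M[R]_(m, n)) (B_ : T -> 'M[R]_(n, p))
    (A : 'M[R]_(m, n)) (B : 'M[R]_(n, p)) :
  A_ t @[t --> F] --> A -> B_ t @[t --> F] --> B ->
  (A_ t *m B_ t) @[t --> F] --> A *m B.
Proof.
move=> cA cB; apply: cvg_mx => i j; rewrite mxE; under eq_cvg do rewrite mxE.
by apply: cvg_sumr => k _; apply: cvgM; exact: cvg_mx_coord.
Qed.

Lemma cvg_trmx m n (A_ : T -> 'M[R]_(m, n)) (A : 'M[R]_(m, n)) :
  A_ t @[t --> F] --> A -> (A_ t)^T @[t --> F] --> A^T.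
Proof.
move=> cA; apply: cvg_mx => i j; rewrite mxE; under eq_cvg do rewrite mxE.
exact: cvg_mx_coord.
Qed.

Lemma cvg_det n (A_ : T -> 'M[R]_n) (A : 'M[R]_n) :
  A_ t @[t --> F] --> A -> \det (A_ t) @[t --> F] --> \det A.
Proof.
move=> cA; apply: cvg_sumr => s _; apply: cvgM; first exact: cvg_cst.
by apply: cvg_prodr => i _; exact: cvg_mx_coord.
Qed.

Lemma cvg_adj n (A_ : T -> 'M[R]_n) (A : 'M[R]_n) :
  A_ t @[t --> F] --> A -> \adj (A_ t) @[t --> F] --> \adj A.
Proof.
move=> cA; apply: cvg_mx => i j; rewrite mxE; under eq_cvg do rewrite mxE.
apply: cvgM; first exact: cvg_cst.
apply: cvg_det; apply: cvg_mx => k l; rewrite !mxE; under eq_cvg do rewrite !mxE.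
exact: cvg_mx_coord.
Qed.

Lemma cvg_oblique_proj m n (U_ V_ : T -> 'M[R]_(m, n)) (U V : 'M[R]_(m, n)) :
  U_ t @[t --> F] --> U -> V_ t @[t --> F] --> V -> \det (U *m V^T) != 0 ->
  oblique_proj (U_ t) (V_ t) @[t --> F] --> oblique_proj U V.
Proof.
move=> cU cV G0.
have cG : (U_ t *m (V_ t)^T) @[t --> F] --> U *m V^T.
  by apply: cvg_mulmx => //; exact: cvg_trmx.
apply: cvg_mulmx => //; apply: cvg_mulmx; first exact: cvg_trmx.
apply: cvg_mx => i j; rewrite mxE; under eq_cvg do rewrite mxE.
apply: cvgM; first by apply: cvgV => //; exact: cvg_det.
by apply: cvg_mx_coord; exact: cvg_adj.
Qed.

End MatrixLimits.

(** * Limits of the construction along approximations *)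

Section ConstructionLimit.
Set Implicit Arguments.
Unset Strict Implicit.
Context {R : realType} {n1 n2 : nat}.
Implicit Types (U V : 'M[R]_(n1, n1 + n2)).

Lemma cvg_constr U V (A_ B_ : nat -> 'M[R]_(n1, n2)) :
  gr_cvg (fun k => gr_chart (A_ k)) U -> gr_cvg (fun k => gr_chart (B_ k)) V ->
  \det (U *m V^T) != 0 ->
  constr1 (A_ k) (B_ k) @[k --> \oo] --> oblique_proj U V /\
  constr2 (A_ k) (B_ k) @[k --> \oo] --> 1%:M - oblique_proj U V.
Proof.
move=> [U_ AU cU] [V_ BV cV] G0.
have cG : \det (U_ k *m (V_ k)^T) @[k --> \oo] --> \det (U *m V^T).
  by apply: cvg_det; apply: cvg_mulmx => //; exact: cvg_trmx.
(* Invertibility of [L] is available only for large [k]; at the other indices [invmx] may take its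
   default value, which does not affect the limit. *)
have L0 : \forall k \near \oo, \det (Lmx (A_ k) (B_ k)) != 0.
  apply: filterS (cvgr_neq0 _ cG G0) => k.
  by rewrite (det_Lmx_plucker (AU k) (BV k)) mulf_eq0 negb_or => /andP[].
have c1 : constr1 (A_ k) (B_ k) @[k --> \oo] --> oblique_proj U V.
  apply: cvg_trans (cvg_oblique_proj cU cV G0).
  apply: near_eq_cvg; apply: filterS L0 => k Lk; rewrite constr1E //.
  by apply: gr_eq_oblique_proj => //; rewrite -det_Lmx.
split=> //.
apply: (@cvg_trans _ ((1%:M - constr1 (A_ k) (B_ k)) @[k --> \oo])).
  by apply: near_eq_cvg; apply: filterS L0 => k Lk; rewrite constr2E.
apply: cvg_mx => i j; rewrite mxE; under eq_cvg do rewrite mxE.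
apply: cvgD; first exact: cvg_cst.
rewrite mxE; under eq_cvg do rewrite mxE.
by apply: cvgN; exact: cvg_mx_coord.
Qed.

End ConstructionLimit.

(** * Generic deformations preserving signs *)

Section Perturbation.
Set Implicit Arguments.
Unset Strict Implicit.
Context {R : realType}.

Lemma digits_inj N k (a b : nat -> nat) :
  (forall j, (a j < N)%N) -> (forall j, (b j < N)%N) ->
  (\sum_(j < k) a j * N ^ j = \sum_(j < k) b j * N ^ j)%N ->
  forall j, (j < k)%N -> a j = b j.
Proof.
elim: k a b => // k IHk a b aN bN; rewrite !big_ord_recl !expn0 !muln1.
have E (c : nat -> nat) : (\sum_(i < k) c (bump 0 i) * N ^ bump 0 i =
    (\sum_(i < k) c i.+1 * N ^ i) * N)%N.
  by rewrite big_distrl; apply: eq_bigr => i _; rewrite /= expnSr mulnA.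
rewrite !E /= => eq_ab.
have a0b0 : a 0 = b 0.
  by have := congr1 (modn^~ N) eq_ab; rewrite /= ![(_ 0 + _)%N]addnC !modnMDl !modn_small.
have N0 : (0 < N)%N by apply: leq_ltn_trans (aN 0).
move: eq_ab; rewrite a0b0 => /addnI/eqP; rewrite eqn_pmul2r // => /eqP eq_ab.
case=> // j jk.
by apply: (IHk (fun i => a i.+1) (fun i => b i.+1)) => // i; rewrite ?aN ?bN.
Qed.

(** Dividing by the positive number [x ^+ e i0] leaves a polynomial in [x] with value [a i0] at 0,
    since by injectivity no other term has that order. *)
Lemma sgr_near0 (I : finType) (a : I -> R) (e : I -> nat) (i0 : I) :
  injective e -> a i0 != 0 -> (forall i, a i != 0 -> (e i0 <= e i)%N) ->
  \forall x \near (0 : R)^'+, Num.sg (\sum_i a i * x ^+ e i) = Num.sg (a i0).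
Proof.
move=> einj ai0 emin.
(* The truncated subtraction is harmless: where [e i < e i0], the coefficient [a i] is 0. *)
pose h : {poly R} := \sum_i a i *: 'X^(e i - e i0).
have hE x : h.[x] = \sum_i a i * x ^+ (e i - e i0).
  by rewrite horner_sum; apply: eq_bigr => i _; rewrite hornerZ hornerXn.
have h0 : h.[0] = a i0.
  rewrite hE (bigD1 i0) //= subnn expr0 mulr1 big1 ?addr0 // => i ii0.
  have [->|/emin ei] := eqVneq (a i) 0; first by rewrite mul0r.
  rewrite expr0n subn_eq0 leqNgt ltn_neqAle ei andbT.
  by rewrite (inj_eq einj) eq_sym ii0 mulr0.
have ch : h.[x] @[x --> (0 : R)^'+] --> a i0.
  by rewrite -h0; apply: cvg_at_right_filter; exact: continuous_horner.
have sgh : \forall x \near (0 : R)^'+, Num.sg h.[x] = Num.sg (a i0).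
  have [lt0|gt0|/eqP] := ltrgtP (a i0) 0; last by rewrite (negPf ai0).
    by apply: filterS (cvgr_lt _ ch _ lt0) => x /ltr0_sg ->; rewrite ltr0_sg.
  by apply: filterS (cvgr_gt _ ch _ gt0) => x /gtr0_sg ->; rewrite gtr0_sg.
near=> x.
have x0 : 0 < x by near: x; exact: nbhs_right_gt.
have -> : \sum_i a i * x ^+ e i = x ^+ e i0 * h.[x].
  rewrite hE mulr_sumr; apply: eq_bigr => i _.
  have [->|/emin ei] := eqVneq (a i) 0; first by rewrite !mul0r mulr0.
  by rewrite mulrCA -exprD subnKC.
rewrite sgrM (gtr0_sg (exprn_gt0 _ x0)) mul1r; near: x; exact: sgh.
Unshelve. all: by end_near. Qed.

Context {m n : nat}.
Implicit Types (U V : 'M[R]_(m, n)) (f g : 'I_m -> 'I_n).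

(* A deformation of the identity in which the monomials contributed by the
   coordinates of U to a given Pluecker coordinate of U *m deform_mx x are
   pairwise distinct powers of x: the exponent of the f-th one, for the
   g-th coordinate, has the digit (f i - g i) mod n in base n at the position
   g i, see plucker_deform. *)
Definition deform_exp (i j : 'I_n) : nat := ((i + (n - j)) %% n * n ^ j)%N.

Definition deform_mx (x : R) : 'M[R]_n := \matrix_(i, j) x ^+ deform_exp i j.

(** As [0 ^+ 0 = 1], it suffices that the exponent vanishes exactly on the diagonal, which is a
    comparison of residues mod [n]. *)
Lemma deform_mx0 : deform_mx 0 = 1%:M.
Proof.
apply/matrixP => i j; rewrite !mxE expr0n /deform_exp muln_eq0 expn_eq0.
have n0 : (0 < n)%N by apply: leq_ltn_trans (ltn_ord i).
rewrite (gtn_eqF n0) /= orbF; congr (_%:R); congr nat_of_bool.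
rewrite -[0%N](modnn n) -[X in _ == X %[mod _]](subnKC (ltnW (ltn_ord j))).
by rewrite eqn_modDr !modn_small.
Qed.

Lemma plucker_deform x U g :
  plucker (U *m deform_mx x) g =
  \sum_(f : {ffun 'I_m -> 'I_n}) plucker U f * x ^+ (\sum_i deform_exp (f i) (g i)).
Proof.
rewrite /plucker -det_tr.
have -> : (colsub g (U *m deform_mx x))^T = (colsub g (deform_mx x))^T *m U^T.
  by apply/matrixP => i j; rewrite !mxE; apply: eq_bigr => k _; rewrite !mxE mulrC.
rewrite det_mulmx_ffun; apply: eq_bigr => f _; rewrite mulrC -det_tr; congr (_ * _).
  by congr (\det _); apply/matrixP => i j; rewrite !mxE.
by rewrite expr_sum; apply: eq_bigr => i _; rewrite !mxE.
Qed.

Lemma deform_exp_inj g : injective g ->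
  injective (fun f : {ffun 'I_m -> 'I_n} => \sum_i deform_exp (f i) (g i))%N.
Proof.
move=> ginj f f' /= eff'; apply/ffunP => i0; apply/val_inj.
have n0 : (0 < n)%N by apply: leq_ltn_trans (ltn_ord (g i0)).
pose d (f : {ffun 'I_m -> 'I_n}) i := ((f i + (n - g i)) %% n)%N.
(* The base-[n] digit at position [j]: [d h i] for the only [i] with [g i = j], or 0 when [j] is
   outside the image of [g]. *)
pose a (h : {ffun 'I_m -> 'I_n}) (j : nat) := (\sum_(i | g i == j :> nat) d h i)%N.
have aE h i : a h (g i) = d h i.
  by rewrite /a (big_pred1 i) // => k; rewrite -[RHS](inj_eq ginj).
have aN h j : (a h j < n)%N.
  have [/existsP [i /eqP <-]|/existsPn H] := boolP [exists i, g i == j :> nat].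
    by rewrite aE ltn_mod.
  by rewrite /a big_pred0 // => i; apply/negbTE.
have sumE (h : {ffun 'I_m -> 'I_n}) :
    (\sum_i deform_exp (h i) (g i) = \sum_(j < n) a h j * n ^ j)%N.
  rewrite (partition_big g xpredT) //=; apply: eq_bigr => j _.
  by rewrite /a big_distrl /=; apply: eq_bigr => i /eqP <-.
have := @digits_inj n n _ _ (aN f) (aN f').
rewrite -!sumE => /(_ eff' _ (ltn_ord (g i0))).
rewrite !aE /d => /eqP; rewrite eqn_modDr !modn_small // => /eqP.
exact.
Qed.

Lemma cvg_deform U : U *m deform_mx x @[x --> (0 : R)^'+] --> U.
Proof.
rewrite -[X in _ --> X]mulmx1 -deform_mx0; apply: cvg_mulmx; first exact: cvg_cst.
apply: cvg_mx => i j; rewrite mxE; under eq_cvg do rewrite mxE.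
apply: cvg_at_right_filter; exact: (@exprn_continuous R _ 0).
Qed.

Lemma same_signs_all U V (c : R) : c != 0 ->
  (forall f, increasing f -> Num.sg (c * plucker U f) = Num.sg (plucker V f)) ->
  forall f, Num.sg (c * plucker U f) = Num.sg (plucker V f).
Proof.
move=> c0 sg f.
have [/(@plucker_increasing R) [g gI [b E]]|finj] := pselect (injective f); last first.
  by rewrite !(plucker_noninj _ finj) mulr0.
by rewrite !E mulrCA sgrM sg // -sgrM.
Qed.

Lemma finfun_eq (f : 'I_m -> 'I_n) : (finfun f : 'I_m -> 'I_n) = f.
Proof. by apply: funext => i; rewrite ffunE. Qed.

(** The same coordinates vanish at [U] and [V], so one [f0] of least exponent dominates both
    expansions. *)
Lemma sgr_plucker_deform U V (c : R) g : c != 0 -> row_free V -> increasing g ->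
  (forall f, increasing f -> Num.sg (c * plucker U f) = Num.sg (plucker V f)) ->
  \forall x \near (0 : R)^'+, plucker (V *m deform_mx x) g != 0 /\
    Num.sg (c * plucker (U *m deform_mx x) g) =
    Num.sg (plucker (V *m deform_mx x) g).
Proof.
move=> c0 /row_free_plucker [f1 f1I f1n] gI /(same_signs_all c0) sg.
pose e (f : {ffun 'I_m -> 'I_n}) := (\sum_i deform_exp (f i) (g i))%N.
have einj : injective e by apply: deform_exp_inj; exact: increasing_inj.
have P1 : plucker V (finfun f1) != 0 by rewrite finfun_eq.
pose P (f : {ffun 'I_m -> 'I_n}) := plucker V f != 0.
have [f0 f0n f0min] := @arg_minnP _ (finfun f1) P e P1.
have sg0 (f : {ffun 'I_m -> 'I_n}) : (c * plucker U f != 0) = (plucker V f != 0).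
  by rewrite -sgr_eq0 sg sgr_eq0.
have HV := @sgr_near0 _ (fun f : {ffun _} => plucker V f) e f0 einj f0n f0min.
have HU : \forall x \near (0 : R)^'+,
    Num.sg (\sum_(f : {ffun 'I_m -> 'I_n}) c * plucker U f * x ^+ e f) =
    Num.sg (c * plucker U f0).
  apply: sgr_near0 => //; first by rewrite sg0.
  by move=> f; rewrite sg0; exact: f0min.
apply: filterS2 HU HV => x HUx HVx; rewrite !plucker_deform; split.
  by rewrite -sgr_eq0 HVx sgr_eq0.
rewrite HVx -sg -HUx mulr_sumr; congr Num.sg.
by apply: eq_bigr => f _; rewrite mulrA.
Qed.

(** Uniformity in [g] comes from finiteness: maps are replaced by finite functions, over which a
    filter is closed under intersection. *)
Lemma near_increasing (P : R -> ('I_m -> 'I_n) -> Prop) :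
  (forall g, increasing g -> \forall x \near (0 : R)^'+, P x g) ->
  \forall x \near (0 : R)^'+, forall g, increasing g -> P x g.
Proof.
move=> H; apply: (filterS (P := fun x : R => forall g : {ffun 'I_m -> 'I_n},
    increasing g -> P x g)).
  by move=> x Hx g gI; rewrite -(finfun_eq g); apply: Hx; rewrite finfun_eq.
apply: (@filter_forall R {ffun 'I_m -> 'I_n}
    (fun h x => increasing h -> P x h) (0 : R)^'+ _) => h.
have [hI|hI] := pselect (increasing h); last exact: nearW.
by apply: filterS (H _ hI) => x.
Qed.

Lemma generic_deform U : row_free U ->
  \forall x \near (0 : R)^'+, generic (U *m deform_mx x).
Proof.
move=> Uf; apply: near_increasing => g gI.
(* Genericity is the nonvanishing part of [sgr_plucker_deform], applied to the pair [U], [U] with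
   factor 1. *)
have sgU f : increasing f -> Num.sg (1 * plucker U f) = Num.sg (plucker U f).
  by rewrite mul1r.
by apply: filterS (sgr_plucker_deform (oner_neq0 R) Uf gI sgU) => x [].
Qed.

Lemma same_signs_deform U V : row_free V -> same_signs U V ->
  \forall x \near (0 : R)^'+, same_signs (U *m deform_mx x) (V *m deform_mx x).
Proof.
move=> Vf [c c0 sg].
have := near_increasing (fun g gI => sgr_plucker_deform c0 Vf gI sg).
by apply: filterS => x H; exists c => // g /H [].
Qed.

Lemma same_signs_gr_eq U V U' V' : gr_eq U' U -> gr_eq V' V ->
  same_signs U V -> same_signs U' V'.
Proof.
move=> /gr_eq_plucker [d d0 dE] /gr_eq_plucker [d' d'0 d'E] [c c0 sg].
exists (c * d' / d); first by rewrite !mulf_neq0 // invr_eq0.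
move=> f fI; rewrite dE d'E (sgrM d') -sg // -sgrM; congr Num.sg.
by field.
Qed.

Lemma generic_gr_eq U V : gr_eq V U -> generic U -> generic V.
Proof.
by move=> /gr_eq_plucker [d d0 dE] gU f fI; rewrite dE mulf_neq0 // gU.
Qed.

Lemma seq_near_right (P : R -> Prop) : (\forall x \near (0 : R)^'+, P x) ->
  exists x_ : nat -> R, (forall k, P (x_ k)) /\ x_ k @[k --> \oo] --> (0 : R)^'+.
Proof.
move=> HP.
have ch : (@harmonic R) k @[k --> \oo] --> (0 : R)^'+.
  move=> A A0; have : \forall k \near \oo, (0 < @harmonic R k -> A (harmonic k)).
    exact: (@cvg_harmonic R _ A0).
  by apply: filterS => k; apply; rewrite /harmonic /= invr_gt0.
have [K _ HK] := ch _ HP.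
(* The shift by [K] makes [P] hold at every index and not only eventually. *)
exists (fun k => harmonic (k + K)%N); split=> [k|].
  by apply: HK => /=; exact: leq_addl.
by apply: (cvg_comp (fun k => k + K)%N _ _ ch); exact: cvg_addnr.
Qed.

End Perturbation.

(** * Existence of generic approximations *)

Section LimitConstruction.
Set Implicit Arguments.
Unset Strict Implicit.
Context {R : realType} {n1 n2 : nat}.
Implicit Types (U V : 'M[R]_(n1, n1 + n2)).

Lemma limit_construction_oblique_proj U V : row_free U -> row_free V ->
  \det (U *m V^T) != 0 ->
  limit_construction U V (oblique_proj U V) (1%:M - oblique_proj U V).
Proof.
move=> Uf Vf G0; split; last by move=> A_ B_ [_ cA cB]; exact: cvg_constr.
have cG : \det ((U *m deform_mx x) *m (V *m deform_mx x)^T) @[x --> (0 : R)^'+]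
    --> \det (U *m V^T).
  by apply: cvg_det; apply: cvg_mulmx; [|apply: cvg_trmx]; exact: cvg_deform.
(* Kept as an implication, because the pair may have only compatible signs. *)
have sgn : \forall x \near (0 : R)^'+, same_signs U V ->
    same_signs (U *m deform_mx x) (V *m deform_mx x).
  have [sg|nsg] := pselect (same_signs U V); last exact: nearW.
  by apply: filterS (same_signs_deform Vf sg) => x.
have H : \forall x \near (0 : R)^'+,
    [/\ generic (U *m deform_mx x), generic (V *m deform_mx x),
        \det ((U *m deform_mx x) *m (V *m deform_mx x)^T) != 0 &
        same_signs U V -> same_signs (U *m deform_mx x) (V *m deform_mx x)].
  near=> x; split; near: x; [exact: generic_deform|exact: generic_deform| |exact: sgn].
  exact: cvgr_neq0 _ cG G0.
have [x_ [Hx cx]] := seq_near_right H.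
have chart (W : 'M[R]_(n1, n1 + n2)) : generic W -> exists A, gr_eq W (gr_chart A).
  by move=> gW; apply: gr_eq_chart; apply: gW; exact: lshift_increasing.
have /choice [A_ HA] k : exists A, gr_eq (U *m deform_mx (x_ k)) (gr_chart A).
  by apply: chart; have [] := Hx k.
have /choice [B_ HB] k : exists A, gr_eq (V *m deform_mx (x_ k)) (gr_chart A).
  by apply: chart; have [] := Hx k.
exists A_, B_; split.
- split.
  + move=> k; have [gU gV _ _] := Hx k.
    split; first exact: generic_gr_eq (gr_eq_sym (HA k)) gU.
    exact: generic_gr_eq (gr_eq_sym (HB k)) gV.
  + exists (fun k => U *m deform_mx (x_ k)) => //.
    exact: (cvg_comp _ _ cx (@cvg_deform _ _ _ U)).
  + exists (fun k => V *m deform_mx (x_ k)) => //.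
    exact: (cvg_comp _ _ cx (@cvg_deform _ _ _ V)).
- move=> k; have [_ _ G _] := Hx k; rewrite unitmxE unitfE.
  by move: G; rewrite (det_Lmx_plucker (HA k) (HB k)) mulf_eq0 negb_or => /andP[].
- move=> sg k; have [_ _ _ /(_ sg)] := Hx k.
  exact: same_signs_gr_eq (gr_eq_sym (HA k)) (gr_eq_sym (HB k)).
Unshelve. all: by end_near. Qed.

End LimitConstruction.

(** * From pure measures to pairs of planes *)

Section PureMeasures.
Set Implicit Arguments.
Unset Strict Implicit.
Context {R : realType}.

(** Complementary ranks force the row spaces of [A] and [1 - A] to meet in 0, and both contain the
    rows of [A *m (1 - A)], since the factors commute. *)
Lemma mxrank_compl_idem n (A : 'M[R]_n) :
  (\rank A + \rank (1%:M - A)%R = n)%N -> A *m A = A.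
Proof.
move=> rkA.
have sub : (A *m (1%:M - A) <= A :&: (1%:M - A))%MS.
  rewrite sub_capmx submxMl andbT.
  have -> : A *m (1%:M - A) = (1%:M - A) *m A.
    by rewrite mulmxBr mulmxBl mulmx1 mul1mx.
  exact: submxMl.
have cap0 : \rank (A :&: (1%:M - A))%MS = 0%N.
  apply/eqP; rewrite -(eqn_add2l (\rank (A + (1%:M - A))%MS)) mxrank_sum_cap rkA addn0.
  rewrite eqn_leq rank_leq_col andbT -[X in (X <= _)%N](@mxrank1 R n).
  apply: mxrankS; rewrite -[X in (X <= _)%MS](subrK A) addrC.
  exact: addmx_sub_adds.
move: sub; move/eqP: cap0; rewrite mxrank_eq0 => /eqP ->.
by rewrite submx0 mulmxBr mulmx1 subr_eq0 => /eqP.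
Qed.

Lemma idem_oblique_proj n (A : 'M[R]_n) : A *m A = A ->
  exists U V : 'M[R]_(\rank A, n),
    [/\ row_free U, row_free V, U *m V^T = 1%:M & A = oblique_proj U V].
Proof.
move=> AA; exists (row_base A), (col_base A)^T.
have VU : col_base A *m row_base A = A by exact: mulmx_base.
(* Writing [A = C R] for the rank factorization, [C (R C) R = A A = A = C R], and [C] and [R] can be
   cancelled. *)
have UV : row_base A *m col_base A = 1%:M.
  apply: (row_free_inj (row_base_free A)); rewrite mul1mx.
  apply: (row_full_inj (col_base_full A)).
  by rewrite -mulmxA VU mulmxA VU AA.
have E : row_base A *m (col_base A)^T^T = 1%:M by rewrite trmxK.
split=> //; first exact: row_base_free.
  by rewrite /row_free mxrank_tr; exact: col_base_full.
by rewrite oblique_projE E ?det1 ?oner_neq0 // trmxK invmx1 mulmx1 VU.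
Qed.

Lemma det2_measure_compatible m n (U V : 'M[R]_(m, n)) : U *m V^T = 1%:M ->
  det2_measure (oblique_proj U V) (1%:M - oblique_proj U V) ->
  compatible_signs U V.
Proof.
move=> UV [_ ge0 _].
have G0 : \det (U *m V^T) != 0 by rewrite UV det1 oner_neq0.
have pl_ge0 f : increasing f -> 0 <= 1 * plucker U f * plucker V f.
  move=> fI; have finj := increasing_inj fI; rewrite mul1r plucker_mul_tr //.
  (* The sequence with letter 1 exactly on the columns of [f]: its probability is the product of the
     [f]-th coordinates, as [U *m V^T = 1]. *)
  pose w : {ffun 'I_n -> 'I_2} :=
    [ffun j => if j \in [set f i | i : 'I_m]%SET then ord0 else ord_max].
  have wE : [set j | w j == ord0]%SET = [set f i | i : 'I_m]%SET.
    by apply/setP => j; rewrite inE ffunE; case: ifP.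
  have := det2_pr_oblique_proj w G0.
  rewrite wE card_imset // card_ord eqxx UV det1 mul1r => <-; exact: ge0.
exists 1; split=> //; apply: contrapT => H.
(* If no product were positive, all would vanish, and Cauchy-Binet would give determinant 0 for
   [U *m V^T = 1]. *)
move: (oner_neq0 R) => /negP; apply; apply/eqP.
have : \det (U *m V^T) *+ m`! = 0.
  rewrite det_mulmx_tr big1 // => f _.
  have [/(@plucker_mul_increasing R) [g gI /(_ U V) E]|/plucker_noninj E] :=
    pselect (injective f); last by rewrite -[\det _]/(plucker U f) E mul0r.
  rewrite -[LHS]/(plucker U f * plucker V f) E; apply/eqP; rewrite -[_ == 0]negbK.
  apply/negP => pl0; apply: H; exists g => //.
  by rewrite lt_neqAle pl_ge0 // mul1r eq_sym pl0.
by move/eqP; rewrite UV det1 pnatr_eq0 -leqn0 leqNgt fact_gt0.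
Qed.

End PureMeasures.

(** * From oblique projections back to the construction *)

Theorem mainTheorem3 (R : realType) (n1 n2 : nat) :
  (* (1), generic case *)
  (forall U1 U2 : 'M[R]_(n1, n1 + n2),
     row_free U1 -> row_free U2 ->
     generic U1 -> generic U2 -> same_signs U1 U2 ->
     (exists A B : 'M[R]_(n1, n2),
        gr_eq U1 (gr_chart A) /\ gr_eq U2 (gr_chart B)) /\
     (forall A B : 'M[R]_(n1, n2),
        gr_eq U1 (gr_chart A) -> gr_eq U2 (gr_chart B) ->
        [/\ 0 < \det (Lmx A B),
            pure_det2_measure (constr1 A B) (constr2 A B) &
            forall w : {ffun 'I_(n1 + n2) -> 'I_2},
              #|[set j | w j == ord0]%SET| = n1 ->
              #|[set j | w j == ord_max]%SET| = n2 ->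
              0 < det2_pr (constr1 A B) (constr2 A B) w])) /\
  (* (1), nongeneric case *)
  (forall U1 U2 : 'M[R]_(n1, n1 + n2),
     row_free U1 -> row_free U2 ->
     same_signs U1 U2 \/ compatible_signs U1 U2 ->
     exists A1 A2 : 'M[R]_(n1 + n2),
       pure_det2_measure A1 A2 /\ limit_construction U1 U2 A1 A2) /\
  (* (2) *)
  (forall A1 A2 : 'M[R]_(n1 + n2),
     pure_det2_measure A1 A2 -> \rank A1 = n1 -> \rank A2 = n2 ->
     exists U1 U2 : 'M[R]_(n1, n1 + n2),
       [/\ row_free U1, row_free U2, compatible_signs U1 U2,
           limit_construction U1 U2 A1 A2 &
           (plucker U1 (@lshift n1 n2) != 0 ->
            plucker U2 (@lshift n1 n2) != 0 ->
            exists A B : 'M[R]_(n1, n2),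
              [/\ gr_eq U1 (gr_chart A), gr_eq U2 (gr_chart B),
                  0 < \det (Lmx A B),
                  A1 = constr1 A B & A2 = constr2 A B])]).
Proof.
have chart_proj (U V : 'M[R]_(n1, n1 + n2)) A B : compatible_signs U V ->
    gr_eq U (gr_chart A) -> gr_eq V (gr_chart B) ->
    plucker U (@lshift n1 n2) != 0 -> plucker V (@lshift n1 n2) != 0 ->
    [/\ 0 < \det (Lmx A B), constr1 A B = oblique_proj U V &
        constr2 A B = 1%:M - oblique_proj U V].
  move=> [c [ge0 ex]] UA VB pU pV.
  have L0 : 0 < \det (Lmx A B).
    (* The positive [c * \det (U *m V^T)] is the product of [\det L] and [c] times the two first
       coordinates; the latter factor is nonnegative, hence positive. *)
    move: (det_mulmx_tr_gt0 ge0 ex); rewrite (det_Lmx_plucker UA VB) !mulrA => cL.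
    have := ge0 _ lshift_increasing; rewrite le0r => /orP [/eqP E|gt0].
      by move: cL; rewrite E mul0r ltxx.
    by move: cL; rewrite pmulr_rgt0.
  have L0' := lt0r_neq0 L0.
  have E : constr1 A B = oblique_proj U V.
    by rewrite constr1E // (gr_eq_oblique_proj UA VB) // -det_Lmx.
  by split; rewrite // constr2E // E.
split; [|split].
- move=> U V Uf Vf gU gV sg; have cs := same_signs_compatible Vf sg.
  have pU := gU _ lshift_increasing; have pV := gV _ lshift_increasing.
  split.
    have [A UA] := gr_eq_chart pU; have [B VB] := gr_eq_chart pV.
    by exists A, B.
  move=> A B UA VB; have [L0 -> ->] := chart_proj _ _ _ _ cs UA VB pU pV.
  split=> // [|w wn _]; first exact: pure_oblique_proj.
  have [c [ge0 ex]] := cs.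
  have c0 : c != 0.
    by have [f _] := ex; apply: contraTneq => ->; rewrite !mul0r ltxx.
  apply: (@det2_pr_oblique_proj_gt0 _ _ _ _ _ c) => //.
    (* Genericity makes the weak inequalities of compatible signs strict. *)
    by move=> f fI; rewrite lt0r ge0 // !mulf_neq0 // ?gU ?gV.
  exact: det_mulmx_tr_gt0.
- move=> U V Uf Vf sg.
  have cs : compatible_signs U V by case: sg => // /(same_signs_compatible Vf).
  exists (oblique_proj U V), (1%:M - oblique_proj U V); split.
    exact: pure_oblique_proj.
  apply: limit_construction_oblique_proj => //.
  have [c [ge0 ex]] := cs; have := det_mulmx_tr_gt0 ge0 ex.
  by apply: contraTneq => ->; rewrite mulr0 ltxx.
- move=> A1 A2 [meas rk] rk1 _.
  have A2E : A2 = 1%:M - A1 by have [<- _ _] := meas; rewrite (addrC A1) addrK.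
  rewrite A2E in rk meas *.
  have [U [V]] := idem_oblique_proj (mxrank_compl_idem rk).
  move: U V; rewrite rk1 => U V [Uf Vf UV AE].
  have G0 : \det (U *m V^T) != 0 by rewrite UV det1 oner_neq0.
  rewrite AE in meas *.
  have cs := det2_measure_compatible UV meas.
  exists U, V; split=> //; first exact: limit_construction_oblique_proj.
  move=> pU pV; have [A UA] := gr_eq_chart pU; have [B VB] := gr_eq_chart pV.
  by exists A, B; have [L0 -> ->] := chart_proj _ _ _ _ cs UA VB pU pV.
Qed.
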